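(* For the 1D Euler and Navier–Stokes systems, the invariant region $$G=\Big\{\mathbf u=(\rho,m,E)^\top\in\mathbb R^3:\ \rho>0,\ E-\frac{m^2}{2\rho}>0\Big\}$$ has the GQL representation $$G_*=\Big\{\mathbf u=(\rho,m,E)^\top\in\mathbb R^3:\ \rho>0,\ \ \varphi(\mathbf u;v_* )>0\quad\forall\, v_*\in\mathbb R\Big\},\qquad \varphi(\mathbf u;v_* ):=E-m v_*+\rho\frac{v_*^2}{2};$$ that is, $G=G_*$, where $\varphi(\cdot\,;v_* )$ is linear in $\mathbf u$ for each fixed $v_*$.
   Context: A GQL (equivalent linear) representation of a set $G\subset\mathbb R^N$ is a set $G_*=G$ described by constraints that are all affine in $\mathbf u$, possibly quantified over extra auxiliary parameters independent of $\mathbf u$. Here $\rho$, $m$, $E$ are the density, momentum and total energy of the fluid. *)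

(* Defs.v *)
From HB Require Import structures.
From mathcomp Require Import all_boot all_order all_algebra.
From mathcomp Require Import all_classical all_reals.

Set Implicit Arguments.
Unset Strict Implicit.
Unset Printing Implicit Defensive.

Import Order.TTheory GRing.Theory Num.Theory.
Local Open Scope classical_set_scope.
Local Open Scope ring_scope.

Definition affine (R : realType) (N : nat) (f : 'cV[R]_N -> R) : Prop :=
  exists (l : {scalar 'cV[R]_N}) (c : R), forall u, f u = l u + c.

(* The constraint f(u; t) > 0 (or f(u; t) >= 0 if cf_weak is set), imposed for
   all values t of an auxiliary parameter. The parameter space may not depend
   on u; a constraint without parameter has cf_param := unit. *)
Record constraint_family (R : realType) (N : nat) := ConstraintFamily {
  cf_param : Type;
  cf_weak : bool;
  cf_fun : 'cV[R]_N -> cf_param -> R }.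

Definition solution_set (R : realType) (N : nat) (I : finType)
    (c : I -> constraint_family R N) : set 'cV[R]_N :=
  [set u | forall (i : I) (t : cf_param (c i)),
             0 < cf_fun u t ?<= if cf_weak (c i)].

Definition GQL_representation (R : realType) (N : nat) (G Gs : set 'cV[R]_N)
    (I : finType) (c : I -> constraint_family R N) : Prop :=
  [/\ Gs = G,
      Gs = solution_set c
    & forall (i : I) (t : cf_param (c i)), affine (fun u => cf_fun u t)].

Section Euler.
Variable R : realType.
Implicit Types (u : 'cV[R]_3) (v : R).

Definition density u : R := u 0 0.
Definition momentum u : R := u 1 0.
Definition energy u : R := u 2 0.

Definition invariant_region : set 'cV[R]_3 :=
  [set u | 0 < density u /\
           0 < energy u - momentum u ^+ 2 / (2 * density u)].

Definition phi u v : R :=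
  energy u - momentum u * v + density u * (v ^+ 2 / 2).

Definition GQL_region : set 'cV[R]_3 :=
  [set u | 0 < density u /\ forall v, 0 < phi u v].

Definition GQL_constraints (i : bool) : constraint_family R 3 :=
  if i then ConstraintFamily false (fun u (_ : unit) => density u)
  else ConstraintFamily false phi.

End Euler.

Arguments invariant_region R : clear implicits.
Arguments GQL_region R : clear implicits.
Arguments GQL_constraints R : clear implicits.

(* Main.v *)
Require Import Defs.
From HB Require Import structures.
From mathcomp Require Import all_boot all_order all_algebra.
From mathcomp Require Import all_classical all_reals.
From mathcomp Require Import ring.

Import Order.TTheory GRing.Theory Num.Theory.
Local Open Scope classical_set_scope.
Local Open Scope ring_scope.

(** For a positive density, [phi u] is a convex quadratic polynomial in the
    auxiliary velocity [v]. Completing the square ([phi_completed_square]) shows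
    that its minimum is the internal energy [E - m ^+ 2 / (2 * rho)], attained at
    the fluid velocity [m / rho]. Hence the nonlinear constraint, positivity of
    the internal energy, says that the minimum over [v] of [phi u v] is
    positive, that is, that [phi u v] is positive for every [v]. For a fixed [v]
    the three components of [u] enter [phi u v] with constant coefficients, so
    each of these constraints is linear in [u]. *)

Lemma phi_completed_square (R : realType) (u : 'cV[R]_3) (v : R) :
  density u != 0 ->
  phi u v = energy u - momentum u ^+ 2 / (2 * density u)
            + density u / 2 * (v - momentum u / density u) ^+ 2.
Proof. by rewrite /phi => rho_neq0; field. Qed.

Lemma invariant_regionE (R : realType) : invariant_region R = GQL_region R.
Proof.
apply/seteqP; split=> u [rho_gt0 pos]; split=> //.
- move=> v; rewrite phi_completed_square ?gt_eqF//.
  apply: ltr_wpDr => //.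
  by apply: mulr_ge0; rewrite ?sqr_ge0// divr_ge0// ltW.
- (* The fluid velocity is the minimizer: there the square vanishes. *)
  have := pos (momentum u / density u).
  by rewrite phi_completed_square ?gt_eqF// subrr expr0n mulr0 addr0.
Qed.

Lemma density_scalar (R : realType) : scalar (@density R).
Proof. by move=> a u w; rewrite /density !mxE. Qed.

Lemma phi_scalar (R : realType) (v : R) :
  scalar (fun u : 'cV[R]_3 => phi u v).
Proof.
by move=> a u w; rewrite /phi /energy /momentum /density !mxE; ring.
Qed.

Lemma scalar_affine (R : realType) (N : nat) (f : 'cV[R]_N -> R) :
  scalar f -> affine f.
Proof.
move=> f_lin.
pose fL := GRing.isLinear.Build R 'cV[R]_N R *%R f f_lin.
pose l : {scalar 'cV[R]_N} := HB.pack f fL.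
by exists l, 0 => u; rewrite addr0.
Qed.

Lemma GQL_region_solution_set (R : realType) :
  GQL_region R = solution_set (GQL_constraints R).
Proof.
apply/seteqP; split=> u.
- by move=> [rho_gt0 phi_gt0] [] t //=; exact: phi_gt0.
- by move=> sol; split=> [|v]; [exact: (sol true tt) | exact: (sol false v)].
Qed.

Theorem theorem4p4 (R : realType) :
  [/\ invariant_region R = GQL_region R,
      GQL_representation (invariant_region R) (GQL_region R)
        (GQL_constraints R)
    & forall v : R, scalar (fun u : 'cV[R]_3 => phi u v)].
Proof.
split; [exact: invariant_regionE | split | exact: phi_scalar].
- by rewrite invariant_regionE.
- exact: GQL_region_solution_set.
- move=> [] t; apply: scalar_affine; [exact: density_scalar | exact: phi_scalar].
Qed.
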